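(* Let $X=(X_0,X_1,\dots)$ be a Markov chain on $[0,\infty)$ with transition kernel $T(\cdot\mid x)$ such that $\int_0^\infty|y-x|^3T(dy\mid x)<\infty$ for all $x\ge0$; let $\mu_k(x)=\int_0^\infty(y-x)^kT(dy\mid x)$, $k=1,2,3$, and assume $\mu_2(x)>0$ for all sufficiently large $x$. Assume: (i) there is a function $\psi_1$ with $\mu_1(x)\le\frac{\mu_2(x)}{2x}[1+\psi_1(x)]$ for all sufficiently large $x$ and $\lim_{x\to\infty}(\log x)\psi_1(x)=0$; (ii) $\lim_{x\to\infty}\frac{\log x}{x}\frac{\mu_3(x)}{\mu_2(x)}=0$; (iii) for each positive integer $m$ there is $\delta=\delta(m)<1$ with $\sup_{x_0\in[0,m]}T([0,m]\mid x_0)\le\delta$. Then there exists $m\in(0,\infty)$ such that the set $C=[0,m)$ is recurrent.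
   Context: For a Borel set $C\subseteq[0,\infty)$, let $\tau_C$ be the smallest $n\ge1$ with $X_n\in C$ ($\infty$ if none). $C$ is recurrent if $P(\tau_C<\infty\mid X_0=x_0)=1$ for every $x_0\in[0,\infty)$. *)

(* Defs.v *)
From HB Require Import structures.
From mathcomp Require Import all_boot all_order all_algebra.
From mathcomp Require Import all_classical all_reals all_analysis.
Set Implicit Arguments. Unset Strict Implicit. Unset Printing Implicit Defensive.
Import Order.TTheory GRing.Theory Num.Theory.
Import numFieldNormedType.Exports.
Local Open Scope classical_set_scope.
Local Open Scope ring_scope.
Local Open Scope ereal_scope.

(* The Markov chain on [0,oo) is given by its transition kernel
   T : R.-pker R ~> R (a probability kernel on the Borel sets of R), with
   T(. | x) concentrated on [0,oo) for x >= 0.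

   hit_within T C n x = P(tau_C <= n | X_0 = x), where
   tau_C = min {n >= 1 | X_n \in C}; computed by first-step analysis:
     P(tau_C <= 0) = 0,
     P(tau_C <= n+1 | X_0 = x) = T(C | x) + \int_{y \notin C} P(tau_C <= n | X_0 = y) T(dy|x). *)
Fixpoint hit_within (R : realType) (T : R.-pker R ~> R) (C : set R) (n : nat)
  : R -> \bar R :=
  match n with
  | O => fun _ => 0
  | S n' => fun x => T x C + \int[T x]_(y in ~` C) hit_within T C n' y
  end.

Definition hit_prob (R : realType) (T : R.-pker R ~> R) (C : set R) (x : R)
  : \bar R := ereal_sup (range (fun n => hit_within T C n x)).

Definition recurrent (R : realType) (T : R.-pker R ~> R) (C : set R) : Prop :=
  forall x0 : R, (0 <= x0)%R -> hit_prob T C x0 = 1.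

Definition mu (R : realType) (T : R.-pker R ~> R) (k : nat) (x : R) : R :=
  fine (\int[T x]_(y in `[0%R, +oo[%classic) (((y - x) ^+ k)%R)%:E).

(* Main.v *)
Require Import Defs.
From HB Require Import structures.
From mathcomp Require Import all_boot all_order all_algebra.
From mathcomp Require Import all_classical all_reals all_analysis.
From mathcomp Require Import measurable_realfun ring lra.
Set Implicit Arguments. Unset Strict Implicit. Unset Printing Implicit Defensive.
Import Order.TTheory GRing.Theory Num.Theory.
Import numFieldNormedType.Exports.
Local Open Scope classical_set_scope.
Local Open Scope ring_scope.

(** V(x) = ln (ln (x + e)) is a Lyapunov function for the chain. Its fourth
    derivative is negative, so its third-order Taylor polynomial at x bounds it
    from above on all of [0, oo), with the signed h^3 term; integrating against
    T(. | x) bounds E V(X_1) through mu_1, mu_2, mu_3, and by (i) and (ii) the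
    bound is at most V(x) for large x, because the ln (ln x) scale leaves a
    term of order - mu_2(x) / (x ln x)^2 against which everything else is
    negligible. If V >= A outside [0, M], then (iii) and induction on n give
    P_x(tau_C > n) <= V(x) / A + delta(M)^n 1_{x <= M}: the chain either climbs
    above M, which is unlikely as V is a supermartingale, or stays in [0, M].
    Let n, then A, tend to infinity. *)

(** * Cubic Taylor bounds from the sign of the fourth derivative *)

Lemma mean_value_gt (R : realType) (f df : R -> R) (a x z : R) :
  (forall t, a < t -> is_derive t 1 f (df t)) -> a < x -> a < z -> z != x ->
  exists c, [/\ a < c, 0 < (c - x) * (z - x) & f z - f x = df c * (z - x)].
Proof.
move=> fD ax az; have fcont u v : a < u -> {within `[u, v], continuous f}.
  move=> au; apply: derivable_within_continuous => t /[!in_itv]/= /andP[ut _].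
  by have [] := fD t (lt_le_trans au ut).
rewrite neq_lt => /orP[zx|xz].
- have [t /[!in_itv]/= /andP[zt _]|c /[!in_itv]/= /andP[zc cx] E] :=
    @MVT _ f df z x zx _ (fcont z x az); first exact/fD/(lt_trans az).
  by exists c; split; [lra|nra|lra].
- have [t /[!in_itv]/= /andP[zt _]|c /[!in_itv]/= /andP[zc cx] E] :=
    @MVT _ f df x z xz _ (fcont x z ax); first exact/fD/(lt_trans ax).
  by exists c; split; [lra|nra|lra].
Qed.

(** With [f x = 0], the mean value theorem gives [f z = df c * (z - x)]; multiplying by [z - x]
    leaves [df c] times a square, so the two sides of [x] need no separate treatment. *)
Lemma sign_of_derive_le0 (R : realType) (f df : R -> R) (a x : R) :
  (forall t, a < t -> is_derive t 1 f (df t)) -> a < x -> f x = 0 ->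
  (forall t, a < t -> df t <= 0) -> forall z, a < z -> (z - x) * f z <= 0.
Proof.
move=> fD ax fx0 df0 z az; have [->|zx] := eqVneq z x; first by rewrite subrr mul0r.
have [c [ac _]] := mean_value_gt fD ax az zx.
rewrite fx0 subr0 => ->; rewrite mulrCA -expr2.
by rewrite mulr_le0_ge0 ?df0 ?sqr_ge0.
Qed.

(** Counterpart of [sign_of_derive_le0]: the mean value point [c] lies strictly on the same side of
    [x] as [z], so the sign of [(c - x) * df c] settles that of [df c * (z - x)]. Alternating the
    two lemmas carries a sign through successive antiderivatives that vanish at [x]. *)
Lemma le0_of_sign_derive (R : realType) (f df : R -> R) (a x : R) :
  (forall t, a < t -> is_derive t 1 f (df t)) -> a < x -> f x = 0 ->
  (forall t, a < t -> (t - x) * df t <= 0) -> forall z, a < z -> f z <= 0.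
Proof.
move=> fD ax fx0 df0 z az; have [->|zx] := eqVneq z x; first by rewrite fx0.
have [c [ac cz]] := mean_value_gt fD ax az zx.
rewrite fx0 subr0 => ->; rewrite -(pmulr_rle0 _ cz).
have -> : (c - x) * (z - x) * (df c * (z - x)) = (c - x) * df c * (z - x) ^+ 2.
  by ring.
by rewrite mulr_le0_ge0 ?df0 ?sqr_ge0.
Qed.

Lemma taylor3_le (R : realType) (f0 f1 f2 f3 f4 : R -> R) (a x y : R) :
  (forall t, a < t -> is_derive t 1 f0 (f1 t)) ->
  (forall t, a < t -> is_derive t 1 f1 (f2 t)) ->
  (forall t, a < t -> is_derive t 1 f2 (f3 t)) ->
  (forall t, a < t -> is_derive t 1 f3 (f4 t)) ->
  (forall t, a < t -> f4 t <= 0) -> a < x -> a < y ->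
  f0 y <= f0 x + f1 x * (y - x) + f2 x / 2 * (y - x) ^+ 2
          + f3 x / 6 * (y - x) ^+ 3.
Proof.
move=> D0 D1 D2 D3 f4le0 ax ay.
(* [g0] is the Taylor remainder and [g1], [g2], [g3] are its derivatives, all zero at [x]. Starting
   from [f4 <= 0], four alternating applications of the two sign lemmas descend to [g0 <= 0], on
   both sides of [x]. *)
pose g3 z := f3 z - f3 x.
pose g2 z := f2 z - (f2 x + f3 x * (z - x)).
pose g1 z := f1 z - (f1 x + f2 x * (z - x) + f3 x / 2 * (z - x) ^+ 2).
pose g0 z := f0 z - (f0 x + f1 x * (z - x) + f2 x / 2 * (z - x) ^+ 2
          + f3 x / 6 * (z - x) ^+ 3).
have G3 z : a < z -> is_derive z 1 g3 (f4 z).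
  by move=> /D3 ?; apply: is_derive_eq; rewrite subr0.
have G2 z : a < z -> is_derive z 1 g2 (g3 z).
  move=> /D2 ?; apply: is_derive_eq; rewrite /g3 /GRing.scale/=; ring.
have G1 z : a < z -> is_derive z 1 g1 (g2 z).
  move=> /D1 ?; apply: is_derive_eq; rewrite /g2 /GRing.scale/=; by field.
have G0 z : a < z -> is_derive z 1 g0 (g1 z).
  move=> /D0 ?; apply: is_derive_eq; rewrite /g1 /GRing.scale/=; by field.
have S3 : forall t, a < t -> (t - x) * g3 t <= 0.
  by apply: (sign_of_derive_le0 G3) => //; rewrite /g3 subrr.
have S2 : forall t, a < t -> g2 t <= 0.
  by apply: (le0_of_sign_derive G2 ax _ S3); rewrite /g2; ring.
have S1 : forall t, a < t -> (t - x) * g1 t <= 0.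
  by apply: (sign_of_derive_le0 G1 ax _ S2); rewrite /g1; ring.
have S0 : g0 y <= 0.
  by apply: (le0_of_sign_derive G0 ax _ S1 ay); rewrite /g0; ring.
by rewrite -subr_le0.
Qed.

Lemma is_derive_ln_inv (R : realType) (z : R) : 1 < z ->
  is_derive z 1 (fun t => (ln t)^-1) (- (z^-1 * (ln z)^-1 ^+ 2)).
Proof.
move=> z1; have lz : ln z != 0 by rewrite gt_eqF ?ln_gt0.
have := is_deriveV lz (is_derive1_ln (lt_trans ltr01 z1)).
by rewrite /GRing.scale/= exprVn mulNr mulrC.
Qed.

Lemma is_derive_inv (R : realType) (z : R) : 0 < z ->
  is_derive z 1 (fun t : R => t^-1) (- (z^-1 ^+ 2)).
Proof.
move=> z0; have := is_deriveV (lt0r_neq0 z0) (is_derive_id z 1).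
by rewrite /GRing.scale/= mulr1 exprVn.
Qed.

(** With P = 1/t and Q = 1/ln t one has P' = -P^2 and Q' = -P Q^2, so every derivative of ln ln t is
    a polynomial in P and Q. The fourth has only negative coefficients, while P and Q are positive
    for t > 1. *)
Lemma taylor3_lnln (R : realType) (x y : R) :
  let p := x^-1 in let q := (ln x)^-1 in 1 < x -> 1 < y ->
  ln (ln y) <= ln (ln x) + p * q * (y - x)
    - p ^+ 2 * (q + q ^+ 2) / 2 * (y - x) ^+ 2
    + p ^+ 3 * (2 * q + 3 * q ^+ 2 + 2 * q ^+ 3) / 6 * (y - x) ^+ 3.
Proof.
move=> p q x1 y1; rewrite -mulNr -mulNr.
pose P (t : R) := t^-1; pose Q (t : R) := (ln t)^-1.
have DP (t : R) : 1 < t -> is_derive t 1 P (- (P t ^+ 2)).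
  by move=> t1; apply: is_derive_inv; lra.
have DQ (t : R) : 1 < t -> is_derive t 1 Q (- (P t * Q t ^+ 2)).
  exact: is_derive_ln_inv.
apply: (@taylor3_le _ (fun t => ln (ln t)) (fun t => P t * Q t)
  (fun t => - (P t ^+ 2 * (Q t + Q t ^+ 2)))
  (fun t => P t ^+ 3 * (2 * Q t + 3 * Q t ^+ 2 + 2 * Q t ^+ 3))
  (fun t => - (P t ^+ 4 *
     (6 * Q t + 11 * Q t ^+ 2 + 12 * Q t ^+ 3 + 6 * Q t ^+ 4))) 1) => // t t1.
- have t0 : 0 < t by lra.
  have ? := @is_derive1_ln R t t0.
  have ? := @is_derive1_ln R (ln t) (ln_gt0 t1).
  have : is_derive t 1 (@ln R \o @ln R) ((ln t)^-1 *: t^-1).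
    exact: is_derive1_comp.
  by rewrite /GRing.scale/= mulrC.
- have ? := DP _ t1; have ? := DQ _ t1.
  by apply: is_derive_eq; rewrite /GRing.scale/=; ring.
- have ? := DP _ t1; have ? := DQ _ t1.
  by apply: is_derive_eq; rewrite /GRing.scale/=; ring.
- have ? := DP _ t1; have ? := DQ _ t1.
  by apply: is_derive_eq; rewrite /GRing.scale/=; ring.
- have P0 : 0 <= P t by rewrite invr_ge0; lra.
  have Q0 : 0 <= Q t by rewrite invr_ge0 ln_ge0// ltW.
  by rewrite oppr_le0 mulr_ge0 ?exprn_ge0// !addr_ge0 ?mulr_ge0 ?exprn_ge0.
Qed.

(** * First-step analysis of the avoidance probabilities *)

Section first_step.
Context {R : realType}.
Implicit Types (T : R.-pker R ~> R) (C : set R) (V : R -> R).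

(** This is P(tau_C > n | X_0 = x). At n = 0 it equals 1 even for x in C, because tau_C counts
    visits from time 1 on. *)
Fixpoint avoid_within T C (n : nat) : R -> \bar R :=
  match n with
  | O => fun _ => 1%E
  | S n' => fun x => (\int[T x]_(y in ~` C) avoid_within T C n' y)%E
  end.

Lemma avoid_within_ge0 T C n x : (0 <= avoid_within T C n x)%E.
Proof. by elim: n x => [|n IH] x //=; apply: integral_ge0 => y _; exact: IH. Qed.

Lemma hit_within_ge0 T C n x : (0 <= hit_within T C n x)%E.
Proof.
elim: n x => [|n IH] x //=; apply: adde_ge0 => //.
by apply: integral_ge0 => y _; exact: IH.
Qed.

Lemma pker_le1 T x A : measurable A -> (T x A <= 1)%E.
Proof.
by move=> mA; rewrite -(prob_kernel (s:=T) x); apply: le_measure; rewrite ?inE.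
Qed.

Lemma pker_setC0 T x A : measurable A -> T x A = 1%E -> T x (~` A) = 0%E.
Proof.
move=> mA TA; have mA' := measurableC mA.
have : (T x A + T x (~` A) = 1)%E.
  by rewrite -measureU ?setICr// setUv; exact: prob_kernel.
rewrite TA; case: (T x (~` A)) => // r.
by rewrite -EFinD => -[r0]; congr EFin; lra.
Qed.

Lemma measurable_integral_pker T (C : set R) (f : R -> \bar R) :
  measurable C -> (forall x, 0 <= f x)%E -> measurable_fun setT f ->
  measurable_fun setT (fun x => \int[T x]_(y in C) f y)%E.
Proof.
move=> mC f0 mf; under eq_fun do rewrite integral_mkcond.
apply: measurable_fun_integral_kernel => [U mU|y|]; first exact: measurable_kernel.
- by rewrite patchE; case: ifP.
- by apply/(measurable_restrictT _ mC)/measurable_funTS.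
Qed.

Lemma measurable_avoid_within T C n : measurable C ->
  measurable_fun setT (avoid_within T C n).
Proof.
move=> mC; elim: n => [|n IH] /=; first exact: measurable_cst.
apply: measurable_integral_pker => //; first exact: measurableC.
exact: avoid_within_ge0.
Qed.

Lemma measurable_hit_within T C n : measurable C ->
  measurable_fun setT (hit_within T C n).
Proof.
move=> mC; elim: n => [|n IH] /=; first exact: measurable_cst.
apply: emeasurable_funD; first exact: measurable_kernel.
apply: measurable_integral_pker => //; first exact: measurableC.
exact: hit_within_ge0.
Qed.

Lemma hit_avoid_within T C n x : measurable C ->
  (hit_within T C n x + avoid_within T C n x = 1)%E.
Proof.
move=> mC; elim: n x => [|n IH] x /=; first by rewrite add0e.
have mC' := measurableC mC.
rewrite -addeA -ge0_integralD//; last 4 first.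
- by move=> y _; exact: hit_within_ge0.
- by apply: measurable_funTS; exact: measurable_hit_within.
- by move=> y _; exact: avoid_within_ge0.
- by apply: measurable_funTS; exact: measurable_avoid_within.
under eq_integral do rewrite IH.
rewrite integral_cst// mul1e -measureU//; last by rewrite setICr.
by rewrite setUv; exact: prob_kernel.
Qed.

Lemma avoid_within_le1 T C n x : measurable C -> (avoid_within T C n x <= 1)%E.
Proof.
by move=> mC; rewrite -(hit_avoid_within T n x mC) leeDr// hit_within_ge0.
Qed.

(** The complement of [[0, m[] also contains the negative reals, where nothing is known about [g];
    they are null for [T x]. On what remains, [m, oo) or [0, oo), [g] dominates, and enlarging the
    domain to [0, oo) only increases the integral since [g >= 0] there. *)
Lemma avoid_within_step T (m : R) (g : R -> \bar R) (n : nat) (x : R) :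
  T x `[0, +oo[%classic = 1%E -> measurable_fun setT g ->
  (forall y, 0 <= y -> (0 <= g y)%E) ->
  (forall y, 0 <= y -> m <= y -> (avoid_within T `[0%R, m[ n y <= g y)%E) ->
  (avoid_within T `[0%R, m[ n.+1 x <= \int[T x]_(y in `[0%R, +oo[%classic) g y)%E.
Proof.
move=> T1 mg g0 ag /=; set E := `[0, +oo[%classic.
have mE : measurable (E : set R) by exact: measurable_itv.
have mC : measurable (~` `[0%R, m[ : set R) by apply: measurableC; exact: measurable_itv.
have ma := measurable_avoid_within T n (measurable_itv `[0%R, m[).
have TN : T x (~` E) = 0%E.
  by apply: pker_setC0.
rewrite (ge0_negligible_integral (measurableC mE) mC _ _ TN); last 2 first.
- exact: measurable_funTS.
- by move=> y _; exact: avoid_within_ge0.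
rewrite setDE setCK.
apply: (@le_trans _ _ (\int[T x]_(y in ~` `[0%R, m[ `&` E) g y)%E).
  apply: ge0_le_integral.
  - exact: measurableI.
  - by move=> y _; exact: avoid_within_ge0.
  - exact: measurable_funTS.
  - exact: measurable_funTS.
  - move=> y [] /=; rewrite /E/= !in_itv/= andbT => /negP + y0.
    by rewrite y0/= -leNgt; exact: ag.
apply: ge0_subset_integral => //; first exact: measurableI.
- exact: measurable_funTS.
- by move=> y; rewrite /E/= in_itv/= andbT; exact: g0.
Qed.

End first_step.

(** * A Lyapunov criterion for recurrence *)

Lemma recurrent_of_lyapunov (R : realType) (T : R.-pker R ~> R) (V : R -> R)
  (m : R) :
  (forall x, 0 <= x -> T x `[0, +oo[%classic = 1%E) ->
  (forall M : nat, (0 < M)%N -> exists delta : R, delta < 1 /\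
     forall x, 0 <= x <= M%:R -> (T x `[0%R, M%:R]%classic <= delta%:E)%E) ->
  measurable_fun setT V -> (forall x, 0 <= x -> 0 <= V x) ->
  (forall A, exists2 M : nat, (0 < M)%N & forall x, M%:R <= x -> A <= V x) ->
  (forall x, 0 <= x ->
     (\int[T x]_(y in `[0%R, +oo[%classic) (V y)%:E < +oo)%E) ->
  (forall x, 0 <= x -> m <= x ->
     (\int[T x]_(y in `[0%R, +oo[%classic) (V y)%:E <= (V x)%:E)%E) ->
  recurrent T `[0%R, m[%classic.
Proof.
move=> T1 Tesc mV V0 Vy PVfin PV x0 x0ge0.
have mC : measurable (`[0%R, m[ : set R) by exact: measurable_itv.
have mE : measurable (`[0, +oo[ : set R) by exact: measurable_itv.
(* The induction on n lives on [m, oo), where the drift inequality holds. One further step from an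
   arbitrary x >= 0 covers [0, m) too, at the price of replacing V(x) by the integral of V against
   [T x], which is finite. *)
have bound (A : R) : 0 < A -> exists d : R, [/\ 0 <= d, d < 1 &
    forall n x, 0 <= x -> (avoid_within T `[0%R, m[ n.+1 x <=
      A^-1%:E * \int[T x]_(y in `[0%R, +oo[%classic) (V y)%:E + (d ^+ n)%:E)%E].
  move=> A0; have [M M0 VM] := Vy A; have [d [d1 Td]] := Tesc M M0.
  (* [d] bounds a probability from above, here the one from the starting point 0. *)
  have d0 : 0 <= d.
    rewrite -lee_fin; apply: le_trans (measure_ge0 (T 0) _) (Td 0 _).
    by rewrite lexx/=; exact: ler0n.
  exists d; split => //.
  pose g n y := (A^-1 * V y + d ^+ n * \1_(`[0, M%:R]%classic) y)%R.
  have mg n : measurable_fun setT (fun y => (g n y)%:E).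
    apply/measurable_EFinP; apply: measurable_funD.
      by apply: measurable_funM => //; exact: measurable_cst.
    by apply: measurable_funM; [exact: measurable_cst|exact: measurable_indic].
  have g0 n y : 0 <= y -> (0 <= (g n y)%:E)%E.
    move=> y0; rewrite lee_fin addr_ge0 ?mulr_ge0 ?invr_ge0 ?exprn_ge0 ?V0//.
    exact: ltW.
  have intg n x : 0 <= x -> (\int[T x]_(y in `[0%R, +oo[%classic) (g n y)%:E =
      A^-1%:E * \int[T x]_(y in `[0%R, +oo[%classic) (V y)%:E
      + (d ^+ n)%:E * T x `[0%R, M%:R]%classic)%E.
    move=> xge0; under eq_integral do rewrite EFinD !EFinM.
    rewrite ge0_integralD//.
    - rewrite !ge0_integralZl_EFin//.
      + rewrite integral_indic//; congr (_ + _ * T x _)%E.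
        apply/setIidl => y /=; rewrite !in_itv/= andbT.
        by move=> /andP[].
      + by apply/measurable_EFinP/measurable_funTS; exact: measurable_indic.
      + by rewrite exprn_ge0.
      + by move=> y /=; rewrite in_itv/= andbT lee_fin; exact: V0.
      + by apply/measurable_EFinP/measurable_funTS.
      + by rewrite invr_ge0 ltW.
    - move=> y /=; rewrite in_itv/= andbT => y0.
      by rewrite mule_ge0 ?lee_fin ?V0// invr_ge0 ltW.
    - apply/measurable_EFinP/measurable_funTS.
      by apply: measurable_funM => //; exact: measurable_cst.
    - by move=> y _; rewrite mule_ge0 ?lee_fin ?exprn_ge0.
    - apply/measurable_EFinP/measurable_funTS.
      by apply: measurable_funM; [exact: measurable_cst|exact: measurable_indic].
  have avoid_g n y : 0 <= y -> m <= y -> (avoid_within T `[0%R, m[ n y <= (g n y)%:E)%E.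
    (* Above [M], V/A >= 1 suffices for every n. In the inductive step with y <= M, integrating
       [g n] does not increase the V/A part, by the drift inequality, and multiplies d^n by a
       probability at most d of landing in [0, M]. For n = 0 and y <= M the indicator supplies the
       1. *)
    elim: n y => [|n IH] y y0 my; last first.
      have [yM|My] := leP y M%:R; last first.
        apply: (le_trans (avoid_within_le1 _ _ _ mC)).
        rewrite lee_fin /g -[leLHS]addr0 lerD ?mulr_ge0 ?exprn_ge0//.
        by rewrite mulrC ler_pdivlMr// mul1r VM// ltW.
      have [] := (avoid_within_step (T1 y y0) (mg n) (g0 n) IH).
      move=> /le_trans; apply; rewrite intg// /g EFinD.
      apply: leeD.
        by rewrite EFinM lee_wpmul2l ?PV// lee_fin invr_ge0 ltW.
      rewrite indicE mem_set /= ?in_itv/= ?y0// mulr1 exprSr EFinM.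
      by rewrite lee_wpmul2l ?lee_fin ?exprn_ge0// Td// y0.
    rewrite lee_fin /g expr0 mul1r indicE.
    have [yM|My] := leP y M%:R.
      rewrite mem_set /= ?in_itv/= ?y0// -[leLHS]add0r lerD//.
      by rewrite mulr_ge0 ?V0// invr_ge0 ltW.
    rewrite -[leLHS]addr0 lerD// mulrC ler_pdivlMr// mul1r VM//.
    exact: ltW.
  move=> n x xge0.
  apply: (le_trans (avoid_within_step (T1 x xge0) (mg n) (g0 n) (avoid_g n))).
  rewrite intg// leeD2l// -[leRHS]mule1 lee_wpmul2l ?lee_fin ?exprn_ge0//.
  by apply: pker_le1; exact: measurable_itv.
apply/eqP; rewrite eq_le; apply/andP; split.
  apply: ge_ereal_sup => _ [n _ <-].
  by rewrite -(hit_avoid_within T n x0 mC) leeDl// avoid_within_ge0.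
apply/lee_addgt0Pr => e e0.
pose K := (\int[T x0]_(y in `[0%R, +oo[%classic) (V y)%:E)%E.
have Kfin : K \is a fin_num.
  rewrite ge0_fin_numE ?PVfin//; apply: integral_ge0 => y /=.
  by rewrite in_itv/= andbT lee_fin; exact: V0.
have K0 : 0 <= fine K.
  by apply: fine_ge0; apply: integral_ge0 => y /=; rewrite in_itv/= andbT lee_fin; exact: V0.
(* This choice gives K/A <= e/2, and the added 1 keeps [A] positive when K = 0. The other half of
   [e] is left for d^n, so [A], and with it [d], is fixed before n. *)
pose A := (fine K + 1) / (e / 2).
have A0 : 0 < A by rewrite divr_gt0 ?divr_gt0//; lra.
have [d [d0 d1 /(_ _ _ x0ge0) bd]] := bound A A0.
have [n dn] : exists n, d ^+ n < e / 2.
  have /cvgrPdist_lt/(_ (e / 2)) : (d ^+ n @[n --> \oo] --> (0 : R)).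
    by apply: cvg_expr; rewrite ger0_norm.
  rewrite divr_gt0// => /(_ isT)[N _ /(_ N (leqnn N))].
  by rewrite sub0r normrN ger0_norm ?exprn_ge0// => ?; exists N.
apply: (@le_trans _ _ (hit_within T `[0%R, m[ n.+1 x0 + e%:E)%E); last first.
  by rewrite leeD2r//; apply: ereal_sup_ubound; exists n.+1.
rewrite -[leLHS](hit_avoid_within T n.+1 x0 mC) leeD2l//; apply: (le_trans (bd n)).
rewrite -/K -(fineK Kfin) -EFinM -EFinD lee_fin.
suff : A^-1 * fine K <= e / 2 by lra.
by rewrite mulrC ler_pdivrMr// /A mulrC divfK ?gt_eqF ?divr_gt0//; lra.
Qed.

(** * Integrating a cubic bound against the kernel *)

Lemma integrable_moment (R : realType) (T : R.-pker R ~> R) (x : R) (k : nat) :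
  (k <= 3)%N ->
  (\int[T x]_(y in `[0%R, +oo[%classic) (`|y - x| ^+ 3)%:E < +oo)%E ->
  (T x).-integrable `[0%R, +oo[%classic (fun y => ((y - x) ^+ k)%:E).
Proof.
move=> k3 fin3; have mE : measurable (`[0, +oo[ : set R) by exact: measurable_itv.
have mh : measurable_fun setT (fun y : R => y - x).
  by apply: measurable_funB => //; exact: measurable_cst.
have mn : measurable_fun setT (fun y : R => `|y - x| ^+ 3).
  by apply: measurable_funX; apply: measurableT_comp.
(* For k <= 3, |h|^k <= 1 + |h|^3: compare with 1 if |h| <= 1 and with |h|^3 otherwise. The majorant
   is integrable because [T x] has finite mass. *)
apply: (@le_integrable _ _ _ _ _ mE _ (fun y => (1 + `|y - x| ^+ 3)%:E)).
- by apply/measurable_EFinP/measurable_funTS; apply: measurable_funX.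
- move=> y _ /=; rewrite lee_fin normrX [leRHS]ger0_norm ?addr_ge0 ?exprn_ge0//.
  have [h1|h1] := leP `|y - x| 1.
    by rewrite -[leLHS]addr0 lerD ?exprn_ge0 ?exprn_ile1.
  by rewrite -[leLHS]add0r lerD// ler_eXn2l.
- apply/integrableP; split.
    by apply/measurable_EFinP/measurable_funTS; apply: measurable_funD.
  under eq_integral => y _ do
    rewrite gee0_abs ?lee_fin ?addr_ge0 ?exprn_ge0// EFinD.
  rewrite ge0_integralD//.
  + rewrite integral_cst// mul1e lte_add_pinfty//.
    exact: (le_lt_trans (pker_le1 _ _ mE) (ltry _)).
  + by apply/measurable_EFinP/measurable_funTS.
Qed.

Lemma integral_le_cubic (R : realType) (T : R.-pker R ~> R) (V : R -> R)
  (x a b c : R) :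
  T x `[0, +oo[%classic = 1%E ->
  (\int[T x]_(y in `[0%R, +oo[%classic) (`|y - x| ^+ 3)%:E < +oo)%E ->
  measurable_fun setT V -> (forall y, 0 <= y -> 0 <= V y) ->
  (forall y, 0 <= y ->
     V y <= V x + a * (y - x) + b * (y - x) ^+ 2 + c * (y - x) ^+ 3) ->
  (\int[T x]_(y in `[0%R, +oo[%classic) (V y)%:E <=
     (V x + a * mu T 1 x + b * mu T 2 x + c * mu T 3 x)%:E)%E.
Proof.
move=> T1 fin3 mV V0 Vle.
have mE : measurable (`[0, +oo[ : set R) by exact: measurable_itv.
have im k : (k <= 3)%N ->
    (T x).-integrable `[0%R, +oo[%classic (fun y => ((y - x) ^+ k)%:E).
  by move=> k3; exact: integrable_moment.
have muE k : (k <= 3)%N ->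
    (\int[T x]_(y in `[0%R, +oo[%classic) ((y - x) ^+ k)%:E = (mu T k x)%:E)%E.
  by move=> k3; rewrite /mu fineK// integrable_fin_num// im.
(* The constant term carries the factor (y - x)^0 so that all four terms are moments; the zeroth
   moment is 1 because [T x] gives mass 1 to [0, oo). *)
pose P (y : R) := ((V x)%:E * ((y - x) ^+ 0)%:E + a%:E * ((y - x) ^+ 1)%:E
  + b%:E * ((y - x) ^+ 2)%:E + c%:E * ((y - x) ^+ 3)%:E)%E.
have iZ r k : (k <= 3)%N ->
    (T x).-integrable `[0%R, +oo[%classic (fun y => (r%:E * ((y - x) ^+ k)%:E)%E).
  by move=> k3; apply: integrableZl => //; exact: im.
have i1 := integrableD mE (iZ (V x) 0%N isT) (iZ a 1%N isT).
have i2 := integrableD mE i1 (iZ b 2%N isT).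
have i3 := integrableD mE i2 (iZ c 3%N isT).
apply: (@le_trans _ _ (\int[T x]_(y in `[0%R, +oo[%classic) P y)%E).
  apply: ge0_le_integral => //.
  - by move=> y /=; rewrite in_itv/= andbT lee_fin; exact: V0.
  - exact/measurable_EFinP/measurable_funTS.
  - exact: measurable_int i3.
  - move=> y /=; rewrite in_itv/= andbT => y0.
    by rewrite /P -!EFinM -!EFinD lee_fin expr0 expr1 mulr1 Vle.
rewrite /P (integralD mE i2 (iZ c 3%N isT)) (integralD mE i1 (iZ b 2%N isT)).
rewrite (integralD mE (iZ (V x) 0%N isT) (iZ a 1%N isT)).
rewrite !integralZl ?im// !muE// -!EFinM -!EFinD lee_fin.
suff -> : mu T 0 x = 1 by rewrite mulr1.
apply: EFin_inj; rewrite -muE//; under eq_integral do rewrite expr0.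
by rewrite integral_cst// mul1e.
Qed.

(** * The drift of ln (ln (x + e)) at large x *)

(** After M2 p^2 q^2 / 2 is factored out, the leading terms L cancel and the q^2 part of the second
    derivative leaves -1. The errors come from the shift e, from psi and from the third moment; they
    are at most 1/4, 1/4 and 1/6, with sum below 1. *)
Lemma lnln_drift_le0 (R : realType) (x e psi M1 M2 M3 : R) :
  let p := (x + e)^-1 in let L := ln (x + e) in let q := L^-1 in
  0 < x -> 0 <= e <= x -> 1 <= L -> 0 < M2 ->
  M1 <= M2 / (2 * x) * (1 + psi) -> `|psi| * L <= 8^-1 -> e * L / x <= 4^-1 ->
  `|M3 / M2| * L * p <= 14^-1 ->
  p * q * M1 - p ^+ 2 * (q + q ^+ 2) / 2 * M2
    + p ^+ 3 * (2 * q + 3 * q ^+ 2 + 2 * q ^+ 3) / 6 * M3 <= 0.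
Proof.
move=> p L q x0 /andP[e0 ex] L1 M20 M1le psiL eLx rL.
have z0 : 0 < x + e by rewrite ltr_pwDl.
have L0 : 0 < L by lra.
have p0 : 0 < p by rewrite invr_gt0.
have q0 : 0 < q by rewrite invr_gt0.
have q1 : q <= 1 by rewrite invf_le1.
have qL : q * L = 1 by rewrite mulVf ?gt_eqF.
pose r := M3 / M2.
have M3E : M3 = r * M2 by rewrite /r divfK// gt_eqF.
have main : (x + e) / x * L * (1 + psi) - L - 1
    + p * L * (2 + 3 * q + 2 * q ^+ 2) * r / 3 <= 0.
  have -> : (x + e) / x * L * (1 + psi) - L =
      e * L / x + (psi * L) * (1 + e / x) by field; rewrite gt_eqF.
  have ex1 : 0 <= e / x <= 1.
    by rewrite divr_ge0 ?ler_pdivrMr ?mul1r ?(ltW x0).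
  have h1 : psi * L * (1 + e / x) <= 4^-1.
    have : psi * L <= 8^-1 by apply: le_trans psiL; rewrite ler_wpM2r ?ler_norm ?ltW.
    by move: ex1 => /andP[]; nra.
  have h2 : p * L * (2 + 3 * q + 2 * q ^+ 2) * r / 3 <= 6^-1.
    (* The 7 is 2 + 3 + 2, using q <= 1; with the hypothesis bound 1/14 it yields (1/14)(7/3) =
       1/6. *)
    have u7 : 0 <= 2 + 3 * q + 2 * q ^+ 2 <= 7 by apply/andP; split; nra.
    have : r * L * p <= 14^-1.
      apply: le_trans rL; rewrite ler_wpM2r ?(ltW p0)// ler_wpM2r ?(ltW L0)//.
      exact: ler_norm.
    have -> : p * L * (2 + 3 * q + 2 * q ^+ 2) * r / 3
      = (r * L * p) * ((2 + 3 * q + 2 * q ^+ 2) / 3) by field.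
    by move: u7 => /andP[]; nra.
  lra.
have M1le' : p * q * M1 <= p * q * (M2 / (2 * x) * (1 + psi)).
  by rewrite ler_wpM2l// mulr_ge0 ?ltW.
suff : p * q * (M2 / (2 * x) * (1 + psi)) - p ^+ 2 * (q + q ^+ 2) / 2 * M2
    + p ^+ 3 * (2 * q + 3 * q ^+ 2 + 2 * q ^+ 3) / 6 * M3 <= 0 by lra.
have -> : p * q * (M2 / (2 * x) * (1 + psi)) - p ^+ 2 * (q + q ^+ 2) / 2 * M2
    + p ^+ 3 * (2 * q + 3 * q ^+ 2 + 2 * q ^+ 3) / 6 * M3 =
  M2 * (p ^+ 2 * q ^+ 2) / 2 * ((x + e) / x * L * (1 + psi) - L - 1
    + p * L * (2 + 3 * q + 2 * q ^+ 2) * r / 3).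
  rewrite M3E /p /q; field.
  by rewrite !gt_eqF.
by rewrite mulr_ge0_le0// divr_ge0// mulr_ge0 ?(ltW M20)// mulr_ge0// exprn_ge0 ?ltW.
Qed.

(** Write ln x = 2 ln (sqrt x) and use ln s < s. This makes the shift error e ln(x + e)/x explicitly
    small. *)
Lemma ln_le_sqrt (R : realType) (x : R) : 0 < x -> ln x <= 2 * Num.sqrt x.
Proof.
move=> x0; have s0 : 0 < Num.sqrt x by rewrite sqrtr_gt0.
rewrite -{1}(sqr_sqrtr (ltW x0)) lnXn// mulr_natl lerMn2r/=.
exact/ltW/ln_sublinear.
Qed.

Theorem theorem4p5 (R : realType) (T : R.-pker R ~> R)
  (hsupp : forall x : R, 0 <= x -> T x `[0, +oo[%classic = 1%E)
  (hmom3 : forall x : R, 0 <= x ->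
     (\int[T x]_(y in `[0%R, +oo[%classic) (`|y - x| ^+ 3)%:E < +oo)%E)
  (hmu2 : \forall x \near +oo, 0 < mu T 2 x)
  (hi : exists psi1 : R -> R,
     (\forall x \near +oo, mu T 1 x <= mu T 2 x / (2 * x) * (1 + psi1 x)) /\
     (ln x * psi1 x @[x --> +oo] --> 0))
  (hii : (ln x / x * (mu T 3 x / mu T 2 x)) @[x --> +oo] --> 0)
  (hiii : forall m : nat, (0 < m)%N -> exists delta : R, delta < 1 /\
     forall x0 : R, 0 <= x0 <= m%:R -> (T x0 `[0%R, m%:R]%classic <= delta%:E)%E) :
  exists m : R, 0 < m /\ recurrent T `[0, m[%classic.
Proof.
case: hi => psi [hmu1 hpsi].
pose e : R := expR 1.
have e2 : 2 <= e by rewrite -[leLHS]/(1 + 1) expR_ge1Dx.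
have lne : ln e = 1 by exact: expRK.
have ln_e y : 0 <= y -> 1 <= ln (y + e).
  by move=> y0; rewrite -lne ler_ln ?posrE; lra.
(* The shift by e makes the inner logarithm at least 1, hence V >= 0, on all of [0, oo). *)
pose V (y : R) := ln (ln (y + e)).
have V0 y : 0 <= y -> 0 <= V y by move=> /ln_e ?; rewrite ln_ge0.
have mV : measurable_fun setT V.
  apply: measurableT_comp; first exact: measurable_ln.
  apply: measurableT_comp; first exact: measurable_ln.
  by apply: measurable_funD => //; exact: measurable_cst.
have PV x : let p := (x + e)^-1 in let q := (ln (x + e))^-1 in 0 <= x ->
    (\int[T x]_(y in `[0%R, +oo[%classic) (V y)%:E <=
     (V x + (p * q) * mu T 1 x + (- (p ^+ 2 * (q + q ^+ 2) / 2)) * mu T 2 x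
      + (p ^+ 3 * (2 * q + 3 * q ^+ 2 + 2 * q ^+ 3) / 6) * mu T 3 x)%:E)%E.
  move=> p q x0; apply: integral_le_cubic; rewrite ?hsupp ?hmom3// => y y0.
  have xe : 1 < x + e by lra.
  have ye : 1 < y + e by lra.
  by have := taylor3_lnln xe ye; rewrite /V opprD addrACA subrr addr0 mulNr.
(* The constants 1/16 and 1/28 are half of the 1/8 and 1/14 in [lnln_drift_le0]; the factor 2 is
   lost in passing from ln (x + e) to ln x. *)
have {}hpsi : \forall x \near +oo, `|ln x * psi x| < 16^-1.
  by move/cvgr0Pnorm_lt : hpsi; apply; rewrite invr_gt0.
have {}hii : \forall x \near +oo, `|ln x / x * (mu T 3 x / mu T 2 x)| < 28^-1.
  by move/cvgr0Pnorm_lt : hii; apply; rewrite invr_gt0.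
have [M [_ HM]] := filterI hmu2 (filterI hmu1 (filterI hpsi hii)).
(* [M + 1] gives the strict x > M required by the eventual hypotheses. The square gives sqrt x >= 16
   e, so that e ln(x + e)/x <= 4 e / sqrt x <= 1/4. *)
pose m := Num.max (M + 1) ((16 * e) ^+ 2).
have m0 : 0 < m by rewrite lt_max exprn_gt0 ?orbT//; lra.
exists m; split=> //; apply: (recurrent_of_lyapunov hsupp hiii mV V0).
- move=> A; pose N := (Num.truncn (expR (expR A))).+1.
  exists N => // x Nx.
  have Ax : expR (expR A) <= x.
    by apply: le_trans Nx; rewrite ltW// truncnS_gt.
  have x0 : 0 < x by apply: lt_le_trans Ax; exact: expR_gt0.
  have lx : expR A <= ln (x + e).
    rewrite -[leLHS]expRK ler_ln ?posrE ?expR_gt0; lra.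
  by rewrite /V -[leLHS]expRK ler_ln ?posrE ?expR_gt0// (lt_le_trans _ lx) ?expR_gt0.
- by move=> x x0; apply: le_lt_trans (PV x x0) (ltry _).
- move=> x x0 mx; apply: (le_trans (PV x x0)); rewrite lee_fin -2!addrA gerDl.
  have [Mx ex] : M < x /\ (16 * e) ^+ 2 <= x.
    by move: mx; rewrite ge_max => /andP[]; split=> //; lra.
  have [M2 [M1 [psix rx]]] := HM x Mx.
  have xgt : 256 * e <= x by nra.
  have xpos : 0 < x by lra.
  have lx0 : 0 <= ln x by rewrite ln_ge0//; lra.
  (* This is x + e <= x^2 under the logarithm. *)
  have Lle : ln (x + e) <= 2 * ln x.
    by rewrite mulr_natl -lnXn// ler_ln ?posrE ?exprn_gt0//; nra.
  rewrite addrA mulNr; apply: (@lnln_drift_le0 _ x e (psi x)) => //.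
  + lra.
  + exact: ln_e.
  + move: psix; rewrite normrM (ger0_norm lx0) => psix.
    apply: (@le_trans _ _ (`|psi x| * (2 * ln x))); first by rewrite ler_wpM2l.
    lra.
  + rewrite ler_pdivrMr//.
    have s0 : 0 <= Num.sqrt x by exact: sqrtr_ge0.
    have se : 16 * e <= Num.sqrt x.
      by rewrite -ler_sqr ?nnegrE ?sqr_sqrtr//; lra.
    (* Chain: e ln(x + e) <= 2 e ln x <= 4 e sqrt x <= (sqrt x)^2 / 4 = x/4. *)
    have := ln_le_sqrt xpos; have := sqr_sqrtr x0; nra.
  + move: rx; rewrite normrM normf_div (ger0_norm lx0) (ger0_norm x0) => rx.
    have pr : 0 <= `|mu T 3 x / mu T 2 x| by [].
    have Lp : ln (x + e) * (x + e)^-1 <= 2 * (ln x / x).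
      rewrite mulrA; apply: ler_pM => //.
      * by apply: le_trans (ln_e _ x0).
      * by rewrite invr_ge0; lra.
      * by rewrite lef_pV2 ?posrE; lra.
    rewrite -mulrA; apply: (@le_trans _ _ (`|mu T 3 x / mu T 2 x| * (2 * (ln x / x)))).
      by rewrite ler_wpM2l.
    lra.
Qed.
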